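(* Let $\mathcal{P}_{short}=\langle v_1,\dots,v_\ell\rangle$ be a path in a text-attributed graph, let $T=\{t_1,\dots,t_S\}$ be its path text, and let $p$ be an autoregressive (causal) language model, with the notation for token blocks and conditional probabilities given in the context. Then the probability of generating the path text token by token equals the probability of generating the path node by node and edge by edge: $$\prod_{i=1}^{\ell}\left[\ \prod_{j=j^*_i}^{\tilde j_i} p\big(t_{j}^{v_i}\,\big|\,t_{<j}^{v_{\le i}},t_{<j}^{e_{<i}}\big)\ \prod_{j=j'_i}^{j''_i} p\big(t_{j}^{e_{i,i+1}}\,\big|\,t_{<j}^{v_{\le i}},t_{<j}^{e_{\le i}}\big)\right]=\prod_{i=1}^{\ell} p\big(\mathcal{X}'_{v_i}\,\big|\,\langle\mathcal{X}'_{v_{<i}},\mathcal{X}_{e_{<i}}\rangle\big)\; p\big(\mathcal{X}_{e_{i,i+1}}\,\big|\,\langle\mathcal{X}'_{v_{\le i}},\mathcal{X}_{e_{<i}}\rangle\big),$$ where for $i=\ell$ the factors belonging to the (non-existent) edge $e_{\ell,\ell+1}$ equal $1$ on both sides.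
   Context: Language model. $\mathcal{D}$ is a finite vocabulary of tokens. A causal (autoregressive) language model specifies next-token probabilities $p(x_i\mid x_{<i})$, $x_{<i}=\{x_1,\dots,x_{i-1}\}$, for tokens in $\mathcal{D}$, and the probability of a sequence $x=\{x_1,\dots,x_q\}$ is $p(x)=\prod_{i=1}^q p(x_i\mid x_{<i})$. Conditional probabilities of a block of consecutive tokens given the preceding tokens are the usual conditional probabilities under this joint law. Path text. Let $\mathcal{P}_{short}=\langle v_1,\dots,v_\ell\rangle$ be a path, with $e_{i,i+1}$ the edge from $v_i$ to $v_{i+1}$. Each node $v_i$ carries a text attribute $\mathcal{X}'_{v_i}$ and each edge $e_{i,i+1}$ a text attribute $\mathcal{X}_{e_{i,i+1}}$, each a finite sequence of tokens of $\mathcal{D}$. The path text is the concatenation $T=\langle\mathcal{X}'_{v_1}|\mathcal{X}_{e_{1,2}}|\mathcal{X}'_{v_2}|\cdots|\mathcal{X}_{e_{\ell-1,\ell}}|\mathcal{X}'_{v_\ell}\rangle=\{t_1,\dots,t_S\}$. Token blocks. The tokens of $\mathcal{X}'_{v_i}$ are those of $T$ with positions $j^*_i\le j\le\tilde j_i$ (first and last token), written $t_j^{v_i}$; the tokens of $\mathcal{X}_{e_{i,i+1}}$ are those with positions $j'_i\le j\le j''_i$, written $t_j^{e_{i,i+1}}$. The blocks are consecutive and fill $\{1,\dots,S\}$ in the order $v_1,e_{1,2},v_2,\dots,e_{\ell-1,\ell},v_\ell$. Prefixes. $t_{<j}^{v_{\le i}}$ is the list of tokens with position $<j$ belonging to nodes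 $v_1,\dots,v_i$. $t_{<j}^{e_{<i}}$ is the list of tokens with position $<j$ belonging to the edges preceding $v_i$, i.e. $e_{1,2},\dots,e_{i-1,i}$; $t_{<j}^{e_{\le i}}$ is the same list for $e_{1,2},\dots,e_{i,i+1}$. $\langle\mathcal{X}'_{v_{<i}},\mathcal{X}_{e_{<i}}\rangle$ is the token sequence (in order of appearance in $T$) formed by the nodes and edges preceding $v_i$, and $\langle\mathcal{X}'_{v_{\le i}},\mathcal{X}_{e_{<i}}\rangle$ the one formed by the nodes up to and including $v_i$ and the edges preceding $v_i$. *)

(* Defs.v *)
From HB Require Import structures.
From mathcomp Require Import all_boot all_order all_algebra.

Set Implicit Arguments.
Unset Strict Implicit.
Unset Printing Implicit Defensive.

Import Order.TTheory GRing.Theory Num.Theory.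
Local Open Scope ring_scope.

(* [next_prob c x] is p(x | c), the probability that the token x follows c. *)
Record causal_lm (R : realFieldType) (D : finType) := CausalLM {
  next_prob : seq D -> D -> R;
  next_prob_ge0 : forall c x, 0 <= next_prob c x;
  next_prob_sum1 : forall c, \sum_(x : D) next_prob c x = 1
}.

Definition seq_prob (R : realFieldType) (D : finType) (p : causal_lm R D)
    (x : seq D) : R :=
  \prod_(i < size x) next_prob p (take i x) (tnth (in_tuple x) i).

(* The joint law of q tokens, on events. *)
Definition joint_prob (R : realFieldType) (D : finType) (p : causal_lm R D)
    (q : nat) (A : {set q.-tuple D}) : R :=
  \sum_(x in A) seq_prob p x.

(* If B has probability 0, the quotient is 0 because 0^-1 = 0. *)
Definition cond_prob (R : realFieldType) (D : finType) (p : causal_lm R D)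
    (q : nat) (A B : {set q.-tuple D}) : R :=
  joint_prob p (A :&: B) / joint_prob p B.

(* p(b | c) for a block b coming right after the tokens c: the events
   "the last size b tokens are b" and "the first size c tokens are c" under the
   joint law of size c + size b tokens. *)
Definition block_prob (R : realFieldType) (D : finType) (p : causal_lm R D)
    (b c : seq D) : R :=
  cond_prob p
    [set x : (size c + size b).-tuple D | drop (size c) x == b]
    [set x : (size c + size b).-tuple D | take (size c) x == c].

(* [edge_text u v] is meaningful only when [adj u v].  An undirected graph is
   the case where [adj] and [edge_text] are symmetric. *)
Record text_attributed_graph (D : finType) (V : Type) := TextAttributedGraph {
  adj : rel V;
  node_text : V -> seq D;
  edge_text : V -> V -> seq D
}.

Record graph_path (D : finType) (V : Type)
    (G : text_attributed_graph D V) := GraphPath {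
  path_head : V;
  path_tail : seq V;
  path_adj : path (adj G) path_head path_tail
}.

(* Nodes are numbered from 0, so the last one is [path_len P - 1], and the edge
   number i joins the nodes number i and i + 1; it exists iff
   i + 1 < [path_len P].  Token positions are numbered from 0 as well. *)
Definition path_len (D : finType) (V : Type) (G : text_attributed_graph D V)
    (P : graph_path G) : nat :=
  (size (path_tail P)).+1.

Definition path_node (D : finType) (V : Type) (G : text_attributed_graph D V)
    (P : graph_path G) (i : nat) : V :=
  nth (path_head P) (path_head P :: path_tail P) i.

Definition Xnode (D : finType) (V : Type) (G : text_attributed_graph D V)
    (P : graph_path G) (i : nat) : seq D :=
  node_text G (path_node P i).

Definition Xedge (D : finType) (V : Type) (G : text_attributed_graph D V)
    (P : graph_path G) (i : nat) : seq D :=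
  edge_text G (path_node P i) (path_node P i.+1).

Definition path_text (D : finType) (V : Type) (G : text_attributed_graph D V)
    (P : graph_path G) : seq D :=
  flatten [seq Xnode P i ++ Xedge P i | i <- iota 0 (path_len P).-1]
    ++ Xnode P (path_len P).-1.

Definition node_start (D : finType) (V : Type) (G : text_attributed_graph D V)
    (P : graph_path G) (i : nat) : nat :=
  (\sum_(k < i) (size (Xnode P k) + size (Xedge P k)))%N.

Definition edge_start (D : finType) (V : Type) (G : text_attributed_graph D V)
    (P : graph_path G) (i : nat) : nat :=
  (node_start P i + size (Xnode P i))%N.

(* [in_node P i j]: the position j of the path text lies in the block of the
   node number i. *)
Definition in_node (D : finType) (V : Type) (G : text_attributed_graph D V)
    (P : graph_path G) (i j : nat) : bool :=
  (node_start P i <= j < node_start P i + size (Xnode P i))%N.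

Definition in_edge (D : finType) (V : Type) (G : text_attributed_graph D V)
    (P : graph_path G) (i j : nat) : bool :=
  (i.+1 < path_len P)%N &&
  (edge_start P i <= j < edge_start P i + size (Xedge P i))%N.

(* Position j belongs to one of the first a nodes or one of the first b edges. *)
Definition in_blocks (D : finType) (V : Type) (G : text_attributed_graph D V)
    (P : graph_path G) (a b j : nat) : bool :=
  [exists k : 'I_a, in_node P k j] || [exists k : 'I_b, in_edge P k j].

(* The tokens of T whose position satisfies Q, in order of appearance. *)
Definition tokens_at (D : finType) (T : seq D) (Q : pred nat) : seq D :=
  mask [seq Q k | k <- iota 0 (size T)] T.

Definition blocks_text (D : finType) (V : Type) (G : text_attributed_graph D V)
    (P : graph_path G) (a b : nat) : seq D :=
  tokens_at (path_text P) (in_blocks P a b).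

Definition blocks_text_before (D : finType) (V : Type)
    (G : text_attributed_graph D V) (P : graph_path G) (a b j : nat) : seq D :=
  tokens_at (path_text P) (fun k => (k < j)%N && in_blocks P a b k).

(* Main.v *)
(** The conditional probability of a block satisfies
    p(c) p(b | c) = p(c b) even when p(c) = 0, because then p(c b) = 0 too; the
    product of the next-token probabilities along the block b satisfies the same
    identity.  Multiplying over the consecutive blocks of the path text, both
    sides telescope to p(T). *)
Require Import Defs.
From mathcomp Require Import all_boot all_order all_algebra.

Set Implicit Arguments.
Unset Strict Implicit.
Unset Printing Implicit Defensive.

Import GRing.Theory.
Local Open Scope ring_scope.

(** * Initial segments of positions and a telescoping product *)

Lemma existsb_ordS n (Q : pred nat) :
  [exists k : 'I_n.+1, Q k] = [exists k : 'I_n, Q k] || Q n.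
Proof.
apply/existsP/orP => [[k Qk]|[/existsP[k Qk]|Qn]].
- have := ltn_ord k; rewrite ltnS leq_eqVlt => /orP[/eqP<-|lt_kn]; first by right.
  by left; apply/existsP; exists (Ordinal lt_kn).
- by exists (widen_ord (leqnSn n) k).
- by exists ord_max.
Qed.

(** Contexts are given by predicates on positions; once such a predicate is shown to cut out an
    initial segment, the context becomes a prefix of the text. *)
Lemma tokens_at_take (D : finType) (T : seq D) (Q : pred nat) n :
  (forall k, Q k = (k < n)%N) -> tokens_at T Q = take n T.
Proof.
move=> QE; rewrite /tokens_at (eq_map QE) {Q QE}.
elim: T n => //= x T IH n.
rewrite -(addn0 1%N) iotaDl -map_comp.
case: n => [|n] /=; last by rewrite -(IH n).
by rewrite -[RHS](take0 T) -(IH 0%N).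
Qed.

(** [u i] and [v i] stand for the probabilities of the text before and through node [i], [f] and [g]
    for the node and edge factors. Multiplicative hypotheses avoid dividing by a possibly zero
    [u i]. *)
Lemma prod_telescope (R : comNzRingType) n (u v f g : nat -> R) :
  u 0%N = 1 ->
  (forall i, (i < n.+1)%N -> u i * f i = v i) ->
  (forall i, (i.+1 < n.+1)%N -> v i * g i = u i.+1) ->
  \prod_(i < n.+1) (f i * (if (i.+1 < n.+1)%N then g i else 1)) = v n.
Proof.
move=> u0 uf vg.
(* The last node has no edge after it, so its factor is split off; every shorter partial product
   ends just after an edge, hence at some [u m]. *)
rewrite big_ord_recr /= ltnn mulr1 -uf //; congr (_ * _).
suff H m : (m <= n)%N ->
    \prod_(i < m) (f i * (if (i.+1 < n.+1)%N then g i else 1)) = u m by exact: H.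
elim: m => [|m IH] lt_mn; first by rewrite big_ord0.
by rewrite big_ord_recr /= IH ?(ltnW lt_mn) // ltnS lt_mn mulrA uf ?vg // ltnW.
Qed.

(** * Chain rule for sequence probabilities *)

Section CausalLM.
Variables (R : realFieldType) (D : finType) (p : causal_lm R D).

Definition token_prob (T : seq D) (j : 'I_(size T)) : R :=
  next_prob p (take j T) (tnth (in_tuple T) j).

Lemma seq_prob_nil : seq_prob p [::] = 1.
Proof. by rewrite /seq_prob big_ord0. Qed.

Lemma seq_prob_rcons c x :
  seq_prob p (rcons c x) = seq_prob p c * next_prob p c x.
Proof.
(* [nth] replaces [tnth], whose index type depends on the sequence, so that the factors of [c] and
   of [rcons c x] can be compared. *)
have E y : seq_prob p y =
    \prod_(i < size y) next_prob p (take i y) (nth x y i).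
  by apply: eq_bigr => i _; rewrite (tnth_nth x).
rewrite !E size_rcons big_ord_recr /= nth_rcons ltnn eqxx -cats1 take_size_cat //.
congr (_ * _); apply: eq_bigr => i _.
by rewrite take_cat nth_cat ltn_ord.
Qed.

(** Extending a sequence only multiplies in further factors; this settles conditioning on a null
    prefix. *)
Lemma seq_prob_cat_eq0 c b : seq_prob p c = 0 -> seq_prob p (c ++ b) = 0.
Proof.
move=> c0; elim/last_ind: b => [|b x IH]; first by rewrite cats0.
by rewrite -rcons_cat seq_prob_rcons IH mul0r.
Qed.

Lemma seq_prob_take (T : seq D) n :
  (n <= size T)%N ->
  seq_prob p (take n T) = \prod_(j < size T | (j < n)%N) token_prob j.
Proof.
elim: n => [|n IH] lt_n; first by rewrite take0 seq_prob_nil big_pred0.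
pose jn := Ordinal lt_n.
(* The default token of [nth] is the one at position [n] itself, which exists because
   [n < size T]. *)
rewrite (take_nth (tnth (in_tuple T) jn)) // seq_prob_rcons IH 1?ltnW //.
rewrite [RHS](bigD1 jn) //= mulrC; congr (_ * _).
  by rewrite /token_prob -(tnth_nth _ (in_tuple T) jn).
by apply: eq_bigl => j; rewrite ltnS ltn_neqAle andbC -val_eqE.
Qed.

Lemma seq_prob_take_block (T : seq D) m n :
  (m <= n <= size T)%N ->
  seq_prob p (take m T) * \prod_(j < size T | (m <= j < n)%N) token_prob j =
  seq_prob p (take n T).
Proof.
case/andP=> le_mn le_n; rewrite !seq_prob_take //; last exact: leq_trans le_n.
rewrite [RHS](bigID (fun j : 'I__ => (j < m)%N)) /=.
congr (_ * _); apply: eq_bigl => j.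
  by rewrite andbC; case: ltnP => // /leq_trans->.
by rewrite -leqNgt andbC.
Qed.

(** Marginalisation. The first token of [y] moves to the end of [c], so the induction generalises
    [c]; the inner sum collapses by induction, the outer one by [next_prob_sum1]. *)
Lemma sum_seq_prob_cat c n :
  \sum_(y : n.-tuple D) seq_prob p (c ++ y) = seq_prob p c.
Proof.
elim: n c => [|n IH] c.
  rewrite (bigD1 [tuple]) //= cats0 big1 ?addr0 // => y.
  by case/eqP; rewrite [LHS]tuple0 [RHS]tuple0.
rewrite (reindex (fun z : D * n.-tuple D => cons_tuple z.1 z.2)) /=; last first.
  exists (fun y : n.+1.-tuple D => (thead y, behead_tuple y)) => [[a y]|y] _ /=.
    by congr (_, _); apply: val_inj.
  by rewrite [RHS]tuple_eta.
rewrite -(pair_bigA _ (fun a (y : n.-tuple D) => seq_prob p (c ++ a :: y))) /=.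
under eq_bigr => a _.
  under eq_bigr => y _ do rewrite -cat_rcons.
  rewrite IH seq_prob_rcons.
  over.
by rewrite -mulr_sumr next_prob_sum1 mulr1.
Qed.

Lemma joint_prob_prefix c n :
  joint_prob p [set x : (size c + n).-tuple D | take (size c) x == c] =
  seq_prob p c.
Proof.
rewrite -(sum_seq_prob_cat c n) /joint_prob.
(* The tuples starting with [c] are parametrised by their last [n] tokens; [tcast] repairs the
   length [size c + n - size c] in the inverse map. *)
rewrite (reindex_onto (fun y : n.-tuple D => cat_tuple (in_tuple c) y)
  (fun x => tcast (addKn (size c) n) [tuple of drop (size c) x])) /=.
  apply: eq_bigl => y; rewrite inE take_size_cat // eqxx /=.
  by apply/eqP/val_inj; rewrite /= val_tcast /= drop_size_cat.
move=> x; rewrite inE => /eqP cx; apply: val_inj.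
by rewrite /= val_tcast /= -[RHS](cat_take_drop (size c)) cx.
Qed.

(** Fixing the first and the last tokens determines the whole tuple, so the event is a singleton. *)
Lemma joint_prob_block c b :
  joint_prob p
    ([set x : (size c + size b).-tuple D | drop (size c) x == b] :&:
     [set x : (size c + size b).-tuple D | take (size c) x == c]) =
  seq_prob p (c ++ b).
Proof.
rewrite (_ : _ :&: _ = [set cat_tuple (in_tuple c) (in_tuple b)]).
  by rewrite /joint_prob big_set1.
apply/setP => x; rewrite !inE -val_eqE /=.
by rewrite -{3}(cat_take_drop (size c) x) eqseq_cat 1?andbC //
           size_takel // size_tuple leq_addr.
Qed.

Lemma seq_prob_block c b :
  seq_prob p c * block_prob p b c = seq_prob p (c ++ b).
Proof.
rewrite /block_prob /cond_prob joint_prob_prefix joint_prob_block.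
have [c0|c_neq0] := eqVneq (seq_prob p c) 0; last by rewrite mulrC divfK.
by rewrite seq_prob_cat_eq0 // c0 mul0r.
Qed.

End CausalLM.

(** * Blocks of the path text as initial segments *)

Section PathText.
Variables (D : finType) (V : Type) (G : text_attributed_graph D V).
Variable P : graph_path G.

(** Built like the first part of [path_text], so that at the last node appending its text gives
    [path_text] by conversion. *)
Definition path_prefix i : seq D :=
  flatten [seq Xnode P k ++ Xedge P k | k <- iota 0 i].

Lemma path_prefixS i :
  path_prefix i.+1 = (path_prefix i ++ Xnode P i) ++ Xedge P i.
Proof.
by rewrite /path_prefix -[i.+1]addn1 iotaD map_cat flatten_cat /= cats0 catA.
Qed.

Lemma node_startS i : node_start P i.+1 = (edge_start P i + size (Xedge P i))%N.
Proof. by rewrite /edge_start /node_start big_ord_recr /= addnA. Qed.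

Lemma size_path_prefix i : size (path_prefix i) = node_start P i.
Proof.
elim: i => [|i IH]; first by rewrite /node_start big_ord0.
by rewrite path_prefixS node_startS !size_cat IH.
Qed.

Lemma path_text_prefix i :
  (i < path_len P)%N ->
  exists r, path_text P = (path_prefix i ++ Xnode P i) ++ r.
Proof.
rewrite ltnS leq_eqVlt => /orP[/eqP->|lt_i].
  by exists [::]; rewrite cats0.
rewrite /path_text /= -(subnKC lt_i) iotaD map_cat flatten_cat.
by rewrite -/(path_prefix i.+1) path_prefixS -!catA catA; eexists.
Qed.

Lemma edge_start_le_size i :
  (i < path_len P)%N -> (edge_start P i <= size (path_text P))%N.
Proof.
by case/path_text_prefix=> r ->; rewrite !size_cat size_path_prefix leq_addr.
Qed.

Lemma node_start_le_size i :
  (i < path_len P)%N -> (node_start P i <= size (path_text P))%N.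
Proof. by move/edge_start_le_size; apply: leq_trans; rewrite leq_addr. Qed.

Lemma take_node_start i :
  (i < path_len P)%N -> take (node_start P i) (path_text P) = path_prefix i.
Proof.
by case/path_text_prefix=> r ->; rewrite -catA take_size_cat ?size_path_prefix.
Qed.

Lemma take_edge_start i :
  (i < path_len P)%N ->
  take (edge_start P i) (path_text P) = path_prefix i ++ Xnode P i.
Proof.
by case/path_text_prefix=> r ->; rewrite take_size_cat // size_cat size_path_prefix.
Qed.

Lemma in_blocksSl a b j : in_blocks P a.+1 b j = in_blocks P a b j || in_node P a j.
Proof.
by rewrite /in_blocks (existsb_ordS _ (fun k => in_node P k j)) orbAC.
Qed.

Lemma in_blocksSr a b j : in_blocks P a b.+1 j = in_blocks P a b j || in_edge P b j.
Proof.
by rewrite /in_blocks (existsb_ordS _ (fun k => in_edge P k j)) orbA.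
Qed.

Lemma ltn_orb_interval m n j : ((j < m) || (m <= j < m + n) = (j < m + n))%N.
Proof. by case: (ltnP j m) => //= lt_jm; rewrite ltn_addr. Qed.

(** Each induction step appends a node and then the edge after it, two intervals starting exactly
    where the covered positions end; the bound on the next index guarantees that this edge
    exists. *)
Lemma in_blocks_prefix i j :
  (i < path_len P)%N -> in_blocks P i i j = (j < node_start P i)%N.
Proof.
elim: i => [|i IH] lt_i.
  rewrite /node_start big_ord0 ltn0; apply/negbTE; rewrite negb_or.
  by apply/andP; split; apply/existsPn => -[].
rewrite in_blocksSr in_blocksSl IH ?(ltnW lt_i) // /in_node ltn_orb_interval.
by rewrite -/(edge_start P i) /in_edge lt_i /= ltn_orb_interval node_startS.
Qed.

Lemma in_blocks_node_prefix i j :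
  (i < path_len P)%N -> in_blocks P i.+1 i j = (j < edge_start P i)%N.
Proof. by move=> lt_i; rewrite in_blocksSl in_blocks_prefix // /in_node ltn_orb_interval. Qed.

Lemma blocks_text_prefix i :
  (i < path_len P)%N -> blocks_text P i i = path_prefix i.
Proof.
move=> lt_i; rewrite -take_node_start //.
by apply: tokens_at_take => k; apply: in_blocks_prefix.
Qed.

Lemma blocks_text_node_prefix i :
  (i < path_len P)%N -> blocks_text P i.+1 i = path_prefix i ++ Xnode P i.
Proof.
move=> lt_i; rewrite -take_edge_start //.
by apply: tokens_at_take => k; apply: in_blocks_node_prefix.
Qed.

(** The blocks cover every position before [j], so restricting to them loses no token there. *)
Lemma blocks_text_before_take a b n j :
  (forall k, in_blocks P a b k = (k < n)%N) -> (j <= n)%N ->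
  blocks_text_before P a b j = take j (path_text P).
Proof.
move=> abE le_jn; apply: tokens_at_take => k; rewrite abE.
by case: ltnP => // /leq_trans->.
Qed.

End PathText.

Theorem theorem3 (R : realFieldType) (D : finType) (V : Type)
    (G : text_attributed_graph D V) (P : graph_path G) (p : causal_lm R D) :
  \prod_(i < path_len P)
    ((\prod_(j < size (path_text P) | in_node P i j)
        next_prob p (blocks_text_before P i.+1 i j)
          (tnth (in_tuple (path_text P)) j)) *
     (if (i.+1 < path_len P)%N then
        \prod_(j < size (path_text P) | in_edge P i j)
          next_prob p (blocks_text_before P i.+1 i.+1 j)
            (tnth (in_tuple (path_text P)) j)
      else 1))
  = \prod_(i < path_len P)
    (block_prob p (Xnode P i) (blocks_text P i i) *
     (if (i.+1 < path_len P)%N then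
        block_prob p (Xedge P i) (blocks_text P i.+1 i)
      else 1)).
Proof.
set T := path_text P; set n := size (path_tail P).
pose u i := seq_prob p (path_prefix P i).
pose v i := seq_prob p (path_prefix P i ++ Xnode P i).
have u0 : u 0%N = 1 by apply: seq_prob_nil.
(* [v n] is the probability of the whole path text, the common value of both sides. *)
transitivity (v n).
  apply: (prod_telescope (u := u)
    (f := fun i => \prod_(j < size T | in_node P i j)
        next_prob p (blocks_text_before P i.+1 i j) (tnth (in_tuple T) j))
    (g := fun i => \prod_(j < size T | in_edge P i j)
        next_prob p (blocks_text_before P i.+1 i.+1 j) (tnth (in_tuple T) j)))
    => // i lt_i.
  - rewrite /u /v -take_edge_start // -take_node_start //.
    rewrite -(@seq_prob_take_block _ _ p _ (node_start P i) (edge_start P i)); last first.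
      by rewrite edge_start_le_size // andbT; apply: leq_addr.
    congr (_ * _); apply: eq_bigr => j /andP[_ lt_j].
    (* A position in node [i] lies below [edge_start P i], where the blocks of its context end. *)
    rewrite (blocks_text_before_take (n := edge_start P i)) // 1?ltnW // => k.
    exact: in_blocks_node_prefix.
  - rewrite /u /v -(take_edge_start (ltnW lt_i)) -take_node_start //.
    rewrite -(@seq_prob_take_block _ _ p _ (edge_start P i) (node_start P i.+1)); last first.
      by rewrite node_start_le_size // node_startS leq_addr.
    rewrite node_startS; congr (_ * _).
    apply: eq_big => j; first by rewrite /in_edge [(_ < path_len P)%N]lt_i.
    case/and3P=> _ _ lt_j.
    (* The first [i.+1] nodes and edges fill the positions before node [i.+1], which exists because
       edge [i] does. *)
    rewrite (blocks_text_before_take (n := node_start P i.+1)) // => [k|].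
      exact: in_blocks_prefix.
    by rewrite node_startS ltnW.
(* On the block side both telescoping hypotheses are instances of the chain rule
   [seq_prob_block]. *)
symmetry; apply: (prod_telescope (u := u)
    (f := fun i => block_prob p (Xnode P i) (blocks_text P i i))
    (g := fun i => block_prob p (Xedge P i) (blocks_text P i.+1 i))) => // i lt_i.
- by rewrite blocks_text_prefix // seq_prob_block.
- by rewrite blocks_text_node_prefix 1?ltnW // seq_prob_block /u path_prefixS.
Qed.
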